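(* The spaces $[0,\omega]\times[0,\mathfrak c]$ and $2^{\mathfrak c}$ satisfy property ($*$). In particular, a product of at least $\mathfrak c$ compact Hausdorff spaces, each with more than one point, satisfies property ($*$).
   Context: $\mathfrak c$ is the cardinality of the continuum (regarded as an initial ordinal). Intervals of ordinals $[0,\alpha]$ carry the order topology; $2=\{0,1\}$ is discrete and $2^{\mathfrak c}$ has the product topology. $C(K)$ is the Banach space of continuous real-valued functions on $K$ with the supremum norm. A biorthogonal system in a Banach space $X$ is a family $(x_i,\gamma_i)_{i\in I}$ with $x_i\in X$, $\gamma_i\in X^*$, $\gamma_i(x_i)=1$ and $\gamma_i(x_j)=0$ for $i\ne j$; it is bounded if $\sup_i\Vert x_i\Vert<+\infty$ and $\sup_i\Vert\gamma_i\Vert<+\infty$; it is weak*-null if $\big(\gamma_i(x)\big)_{i\in I}\in c_0(I)$ for all $x\in X$. A compact Hausdorff space $K$ satisfies property ($*$) if there exist a sequence $(F_n)_{n\in\omega}$ of closed subsets of $K$ and a bounded weak*-null biorthogonal system $(f_{n,\alpha},\gamma_{n,\alpha})_{n\in\omega,\alpha\in\mathfrak c}$ in $C(K)$ such that $F_n\cap\overline{\bigcup_{m\ne n}F_m}=\emptyset$ for all $n\in\omega$ and $\operatorname{supp} f_{n,\alpha}\subset F_n$ for all $n\in\omega$, $\alpha\in\mathfrak c$, where $\operatorname{supp}$ denotes the (closed) support. *)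

(* Defs.v *)
From HB Require Import structures.
From mathcomp Require Import all_boot all_order all_algebra.
From mathcomp Require Import all_classical all_reals all_analysis.
From mathcomp Require wochoice.

Set Implicit Arguments.
Unset Strict Implicit.
Unset Printing Implicit Defensive.

Import Order.TTheory GRing.Theory Num.Theory.
Import numFieldNormedType.Exports.
Local Open Scope classical_set_scope.
Local Open Scope card_scope.
Local Open Scope ring_scope.

HB.mixin Record isCompactHausdorff T & Topological T := {
  compactT : compact [set: T];
  hausdorffT : hausdorff_space T
}.

#[short(type="compactHausdorffType")]
HB.structure Definition CompactHausdorff :=
  {T of Topological T & isCompactHausdorff T}.

HB.instance Definition _ :=
  isCompactHausdorff.Build bool bool_compact discrete_hausdorff.

Section ProductInstances.

Lemma pair_compactT (K L : compactHausdorffType) : compact [set: K * L].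
Proof. by rewrite -setXTT; apply: compact_setX; exact: compactT. Qed.

Lemma pair_hausdorff (K L : compactHausdorffType) : hausdorff_space (K * L)%type.
Proof.
move=> [x1 x2] [y1 y2] xy; congr (_, _); apply: hausdorffT => A B Ax By.
  have [||[z1 z2] [[/= ? _] [/= ? _]]] := xy (A `*` setT) (B `*` setT).
  - by exists (A, setT) => //; split => //; exact: filterT.
  - by exists (B, setT) => //; split => //; exact: filterT.
  by exists z1.
have [||[z1 z2] [[/= _ ?] [/= _ ?]]] := xy (setT `*` A) (setT `*` B).
- by exists (setT, A) => //; split => //; exact: filterT.
- by exists (setT, B) => //; split => //; exact: filterT.
by exists z2.
Qed.

HB.instance Definition _ (K L : compactHausdorffType) :=
  isCompactHausdorff.Build (K * L)%type
    (@pair_compactT K L) (@pair_hausdorff K L).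

Lemma prod_compactT (I : Type) (K : I -> compactHausdorffType) :
  compact [set: prod_topology K].
Proof.
have := @tychonoff {classic I} K (fun=> setT) (fun i => @compactT (K i)).
by congr compact; apply/seteqP; split.
Qed.

Lemma prod_hausdorff (I : Type) (K : I -> compactHausdorffType) :
  hausdorff_space (prod_topology K).
Proof.
exact: (@hausdorff_product {classic I} K (fun i => @hausdorffT (K i))).
Qed.

HB.instance Definition _ (I : Type) (K : I -> compactHausdorffType) :=
  isCompactHausdorff.Build (prod_topology K)
    (@prod_compactT I K) (@prod_hausdorff I K).

End ProductInstances.

(** An ordinal [alpha] is represented by a well-ordered type [A] of order type
[alpha], whose elements stand for the ordinals below [alpha]. *)

HB.mixin Record isWellOrder d T & Order.Total d T := {
  well_order_min :
    forall A : set T, A !=set0 -> exists2 m, A m & forall x, A x -> (m <= x)%O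
}.

#[short(type="wellOrderType")]
HB.structure Definition WellOrder d := {T of Order.Total d T & isWellOrder d T}.

Lemma nat_well_order (A : set nat) :
  A !=set0 -> exists2 m, A m & forall x, A x -> (m <= x)%O.
Proof.
move=> [n An]; have exA : exists n, `[< A n >] by exists n; exact/asboolP.
exists (ex_minn exA); case: ex_minnP => m /asboolP Am mle // x Ax.
by rewrite leEnat; apply: mle; exact/asboolP.
Qed.

HB.instance Definition _ := isWellOrder.Build _ nat nat_well_order.

(** The closed interval [[0, alpha]]: [Some a] is the ordinal [a < alpha] and
[None] is [alpha] itself. *)
Definition ordinal_itv (A : Type) : Type := option A.

Fact ordinal_itv_display : Order.disp_t. Proof. exact: Order.Disp tt tt. Qed.

Section OrdinalInterval.
Context {d : Order.disp_t} {A : wellOrderType d}.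
Local Notation oA := (ordinal_itv A).

Definition ordinal_itv_le (x y : oA) : bool :=
  match x, y with
  | _, None => true
  | None, Some _ => false
  | Some a, Some b => (a <= b)%O
  end.

Lemma ordinal_itv_le_refl : reflexive ordinal_itv_le.
Proof. by case=> /=. Qed.

Lemma ordinal_itv_le_anti : antisymmetric ordinal_itv_le.
Proof. by case=> [a|] [b|] //= /le_anti ->. Qed.

Lemma ordinal_itv_le_trans : transitive ordinal_itv_le.
Proof. by case=> [a|] [b|] [c|] //=; exact: le_trans. Qed.

Lemma ordinal_itv_le_total : total ordinal_itv_le.
Proof. by case=> [a|] [b|] //=; exact: le_total. Qed.

HB.instance Definition _ := Choice.on oA.
HB.instance Definition _ := Order.Le_isPOrder.Build ordinal_itv_display oA
  ordinal_itv_le_refl ordinal_itv_le_anti ordinal_itv_le_trans.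
HB.instance Definition _ :=
  Order.POrder_isTotal.Build ordinal_itv_display oA ordinal_itv_le_total.
HB.instance Definition _ := OrderTopological.copy oA (order_topology oA).

Lemma ordinal_itv_leE (x y : oA) : (x <= y)%O = ordinal_itv_le x y.
Proof. by []. Qed.

Lemma ordinal_itv_well_order (S : set oA) :
  S !=set0 -> exists2 m, S m & forall x, S x -> (m <= x)%O.
Proof.
have [[a Sa] _|nS] := pselect (exists a, S (Some a)).
  have [|m Sm mle] := @well_order_min _ A [set a | S (Some a)]; first by exists a.
  by exists (Some m) => // -[b|] // /mle.
by move=> [[a|] Sa]; [case: nS; exists a|exists None => // -[b|] // Sb; case: nS; exists b].
Qed.

HB.instance Definition _ := isWellOrder.Build _ oA ordinal_itv_well_order.

Lemma ordinal_itv_compactT : compact [set: oA].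
Proof.
move=> F FF _.
have [|m Fm mle] := @well_order_min _ oA [set x | F [set y | (y <= x)%O]].
  by exists None; rewrite /= (_ : mkset _ = setT);
    [exact: filterT|apply/seteqP; split=> // -[]].
exists m; split => // B U FB; rewrite itv_nbhsE => -[[b c] [oi mi] iU].
move: mi => /andP[/= bm mc].
have [y By [by_ ym]] : exists2 y, B y & (b <= BLeft y)%O /\ (y <= m)%O.
  case: b oi bm {iU mc} => [[] a|[]] oi bm.
  - by move: oi; case: c => [[]|[]].
  - apply: contrapT => nB; have am : (a < m)%O by [].
    suff : (m <= a)%O by rewrite leNgt am.
    apply: mle => /=; apply: filterS (filterI FB Fm) => y [By /= ym].
    by rewrite leNgt; apply/negP => ay; apply: nB; exists y.
  - by have [y [By ym]] := filter_ex (filterI FB Fm); exists y.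
  - by [].
exists y; split => //; apply: iU => /=.
by apply/andP; split => //=; apply: le_trans mc.
Qed.

HB.instance Definition _ :=
  isCompactHausdorff.Build oA ordinal_itv_compactT order_hausdorff.

End OrdinalInterval.

Definition initial_well_order (T : Type) (r : rel T) : Prop :=
  wochoice.well_order r /\
  forall x, ~~ ([set: T] #<= [set y | r y x /\ y <> x]).

Lemma initial_well_order_exists (T : pointedType) :
  exists r : rel T, initial_well_order r.
Proof.
have [r wor] := wochoice.well_ordering_principle T.
have worT : wochoice.wo_chain r predT by move=> A _; exact: wor.
have ranti x y : r x y -> r y x -> x = y.
  move=> xy yx; apply: (wochoice.wo_chain_antisymmetric worT) => //.
  by rewrite xy yx.
pose bad x := `[< [set: T] #<= [set y | r y x /\ y <> x] >].
have [[x badx]|nbad] := pselect (exists x, bad x); last first.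
  by exists r; split => // x; apply/negP => /asboolT bx; apply: nbad; exists x.
have {x badx} [m [[/asboolP badm mmin] _]] := wor bad (ex_intro _ x badx).
move: badm => /pcard_leP/injfunPex[f fS finj'].
have fseg y : r (f y) m /\ f y <> m by apply: (fS y).

have finj : injective f by move=> y z; apply: finj'; rewrite inE.
have rtot x y : r x y || r y x by exact: (wochoice.wo_chainW worT).
exists (fun y z => r (f y) (f z)); split.
  apply: wochoice.antisymmetric_well_order.
    by move=> y z /andP[yz zy]; exact/finj/ranti.
  move=> A [a Aa]; pose fA : {pred T} := [pred t | `[< exists2 y, y \in A & f y = t >]].
  have [|t [[/asboolP[y Ay yt] tle] _]] := wor fA.
    by exists (f a); apply/asboolP; exists a.
  exists y; split => // z Az; rewrite yt; apply: tle.
  by apply/asboolP; exists z.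
move=> x; apply/negP => Tx.
have [fxm fxNm] := fseg x.
apply: fxNm; apply: ranti => //; apply: mmin; apply/asboolP.
apply: card_le_trans Tx _; apply/pcard_leP/injfunPex; exists f.
  by move=> y [yx yNx]; split => // /finj.
by move=> y z _ _ /finj.
Qed.

Section Continuum.
Variable R : realType.

(** The initial ordinal [c]: the real line, reordered by a well-order all of
whose proper initial segments have cardinality less than the continuum. *)
Definition continuum : Type := R.

Definition continuum_le : rel continuum :=
  projT1 (cid (initial_well_order_exists R)).

Lemma continuum_leP : initial_well_order continuum_le.
Proof. exact: (projT2 (cid (initial_well_order_exists R))). Qed.

Let worT : wochoice.wo_chain continuum_le predT.
Proof. by move=> A _; case: continuum_leP => + _; apply. Qed.

Lemma continuum_le_refl : reflexive continuum_le.
Proof. by move=> x; exact: (wochoice.wo_chain_reflexive worT). Qed.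

Lemma continuum_le_anti : antisymmetric continuum_le.
Proof. by move=> x y; exact: (wochoice.wo_chain_antisymmetric worT). Qed.

Lemma continuum_le_total : total continuum_le.
Proof. by move=> x y; exact: (wochoice.wo_chainW worT). Qed.

Lemma continuum_le_min (A : set continuum) :
  A !=set0 -> exists2 m, A m & forall x, A x -> continuum_le m x.
Proof.
move=> [a Aa]; have [wo _] := continuum_leP.
have [|m [[/set_mem Am mle] _]] := wo (mem A); first by exists a; exact/mem_set.
by exists m => // x Ax; apply: mle; exact/mem_set.
Qed.

Lemma continuum_le_trans : transitive continuum_le.
Proof.
move=> y x z xy yz.
have [|m Am mle] := @continuum_le_min [set x; y; z]; first by exists x; left; left.
have mx : continuum_le m x by apply: mle; left; left.
have my : continuum_le m y by apply: mle; left; right.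
have mz : continuum_le m z by apply: mle; right.
case: Am => [[|]|] mE; rewrite {}mE in mx my mz => //.
  by rewrite (@continuum_le_anti x y) ?xy.
have zy : z = y by apply: continuum_le_anti; rewrite my yz.
by rewrite zy.
Qed.

Fact continuum_display : Order.disp_t. Proof. exact: Order.Disp tt tt. Qed.

HB.instance Definition _ := Choice.on continuum.
HB.instance Definition _ := Order.Le_isPOrder.Build continuum_display continuum
  continuum_le_refl continuum_le_anti continuum_le_trans.
HB.instance Definition _ :=
  Order.POrder_isTotal.Build continuum_display continuum continuum_le_total.
HB.instance Definition _ :=
  isWellOrder.Build continuum_display continuum continuum_le_min.

Lemma continuum_initial (x : continuum) :
  ~~ ([set: R] #<= [set y : continuum | (y < x)%O]).
Proof.
have [_ /(_ x)] := continuum_leP; congr (~~ (_ #<= _)).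
apply/seteqP; split=> y /=; rewrite lt_neqAle.
  by move=> [yx /eqP yNx]; apply/andP.
by move=> /andP[/eqP].
Qed.

End Continuum.

Section ContinuousFunctions.
Variables (R : realType) (K : compactHausdorffType).

Definition Cspace : Type := continuousType K R.

HB.instance Definition _ := Choice.on Cspace.

Definition CspaceOf (f : K -> R) (fc : continuous f) : Cspace :=
  [the continuousType K R of mkcts fc].

Lemma CspaceP (f g : Cspace) : (forall x, f x = g x) -> f = g.
Proof. by move=> fg; apply/continuousEP. Qed.

Lemma Cspace_continuous (f : Cspace) : continuous f.
Proof. exact: (@cts_fun _ _ f). Qed.

Lemma Cspace0_subproof : continuous (fun _ : K => 0 : R).
Proof. by move=> x; exact: cvg_cst. Qed.

Lemma CspaceD_subproof (f g : Cspace) : continuous (fun x => f x + g x).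
Proof. by move=> x; apply: cvgD; exact: Cspace_continuous. Qed.

Lemma CspaceN_subproof (f : Cspace) : continuous (fun x => - f x).
Proof. by move=> x; apply: cvgN; exact: Cspace_continuous. Qed.

Lemma CspaceZ_subproof (a : R) (f : Cspace) : continuous (fun x => a * f x).
Proof. by move=> x; apply: cvgMr; exact: Cspace_continuous. Qed.

Definition Cspace0 := CspaceOf Cspace0_subproof.
Definition CspaceD f g := CspaceOf (@CspaceD_subproof f g).
Definition CspaceN f := CspaceOf (@CspaceN_subproof f).
Definition CspaceZ a f := CspaceOf (@CspaceZ_subproof a f).

Fact CspaceDA : associative CspaceD.
Proof. by move=> f g h; apply: CspaceP => x; exact: addrA. Qed.
Fact CspaceDC : commutative CspaceD.
Proof. by move=> f g; apply: CspaceP => x; exact: addrC. Qed.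
Fact Cspace0D : left_id Cspace0 CspaceD.
Proof. by move=> f; apply: CspaceP => x; exact: add0r. Qed.
Fact CspaceND : left_inverse Cspace0 CspaceN CspaceD.
Proof. by move=> f; apply: CspaceP => x; exact: addNr. Qed.

HB.instance Definition _ :=
  GRing.isZmodule.Build Cspace CspaceDA CspaceDC Cspace0D CspaceND.

Fact CspaceZA a b f : CspaceZ a (CspaceZ b f) = CspaceZ (a * b) f.
Proof. by apply: CspaceP => x; exact: mulrA. Qed.
Fact Cspace1Z : left_id 1 CspaceZ.
Proof. by move=> f; apply: CspaceP => x; exact: mul1r. Qed.
Fact CspaceZDr : right_distributive CspaceZ +%R.
Proof. by move=> a f g; apply: CspaceP => x; exact: mulrDr. Qed.
Fact CspaceZDl f : {morph CspaceZ^~ f : a b / a + b}.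
Proof. by move=> a b; apply: CspaceP => x; exact: mulrDl. Qed.

HB.instance Definition _ := GRing.Zmodule_isLmodule.Build R Cspace
  CspaceZA Cspace1Z CspaceZDr CspaceZDl.

Definition sup_norm (f : Cspace) : R := sup (range (fun x => `|f x|)).

Lemma sup_norm_has_ubound (f : Cspace) : has_ubound (range (fun x => `|f x|)).
Proof.
have fK : compact (f @` setT).
  apply: continuous_compact; last exact: compactT.
  by apply: continuous_subspaceT => x; exact: Cspace_continuous.
have [M [_ /(_ (M + 1))]] := compact_bounded fK.
rewrite ltrDl ltr01 => /(_ isT) fM.
by exists (M + 1) => _ [x _ <-]; apply: fM; exists x.
Qed.

Lemma sup_norm_ge (f : Cspace) x : `|f x| <= sup_norm f.
Proof. by apply: (ub_le_sup (sup_norm_has_ubound f)); exists x. Qed.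

Lemma sup_norm_ge0 (f : Cspace) : 0 <= sup_norm f.
Proof.
have [[x _]|nK] := pselect (exists x : K, True).
  exact: le_trans (normr_ge0 (f x)) (sup_norm_ge f x).
rewrite /sup_norm; suff -> : range (fun x => `|f x|) = set0 by rewrite sup0.
by apply/seteqP; split => // _ [x _ <-]; apply: nK; exists x.
Qed.

Lemma sup_norm_le (f : Cspace) (M : R) :
  0 <= M -> (forall x, `|f x| <= M) -> sup_norm f <= M.
Proof.
move=> M0 fM; have [[x _]|nK] := pselect (exists x : K, True).
  apply: ge_sup; first by exists `|f x|, x.
  by move=> _ [y _ <-].
rewrite /sup_norm; suff -> : range (fun x => `|f x|) = set0 by rewrite sup0.
by apply/seteqP; split => // _ [x _ <-]; apply: nK; exists x.
Qed.

Fact sup_normD (f g : Cspace) : sup_norm (f + g) <= sup_norm f + sup_norm g.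
Proof.
apply: sup_norm_le => [|x]; first by rewrite addr_ge0 ?sup_norm_ge0.
by apply: le_trans (ler_normD _ _) _; rewrite lerD ?sup_norm_ge.
Qed.

Fact sup_normZ (a : R) (f : Cspace) : sup_norm (a *: f) = `|a| * sup_norm f.
Proof.
have le_normZ b (g : Cspace) : sup_norm (b *: g) <= `|b| * sup_norm g.
  apply: sup_norm_le => [|x]; first by rewrite mulr_ge0 ?sup_norm_ge0.
  by rewrite /= normrM ler_wpM2l ?sup_norm_ge.
apply/eqP; rewrite eq_le le_normZ /=; have [->|a0] := eqVneq a 0.
  by rewrite normr0 mul0r sup_norm_ge0.
rewrite -ler_pdivlMl ?normr_gt0// -normfV.
by have := le_normZ a^-1 (a *: f); rewrite scalerA mulVf// scale1r.
Qed.

Fact sup_norm_eq0 (f : Cspace) : sup_norm f = 0 -> f = 0.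
Proof.
move=> f0; apply: CspaceP => x; apply/normr0_eq0/le_anti.
by rewrite normr_ge0 andbT -f0 sup_norm_ge.
Qed.

HB.instance Definition _ := Lmodule_isNormed.Build R Cspace
  sup_normD sup_normZ sup_norm_eq0.

Lemma Cspace_normE (f : Cspace) : `|f| = sup (range (fun x => `|f x|)).
Proof. by []. Qed.

Definition supp (f : Cspace) : set K := closure [set x | f x <> 0].

End ContinuousFunctions.

Section Biorthogonal.
Context {R : realType} {X : normedModType R}.

Record dual := Dual {
  dual_fun :> {linear X -> R^o};
  dual_continuous : continuous dual_fun
}.

Definition dual_norm (g : dual) : R :=
  sup [set `|g x| | x in [set x : X | `|x| <= 1]].

Definition c0 (I : Type) (a : I -> R) : Prop :=
  forall e : R, 0 < e -> finite_set [set i | e <= `|a i|].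

Context {I : Type} (x : I -> X) (gamma : I -> dual).

Definition biorthogonal : Prop :=
  (forall i, gamma i (x i) = 1) /\ (forall i j, i <> j -> gamma i (x j) = 0).

Definition bounded_system : Prop :=
  (exists M : R, forall i, `|x i| <= M) /\
  (exists M : R, forall i, dual_norm (gamma i) <= M).

Definition weakstar_null : Prop := forall y : X, c0 (fun i => gamma i y).

End Biorthogonal.

Arguments dual {R} X.

Definition property_star (R : realType) (K : compactHausdorffType) : Prop :=
  exists (F : nat -> set K)
    (f : nat * continuum R -> Cspace R K)
    (gamma : nat * continuum R -> dual (Cspace R K)),
    [/\ [/\ biorthogonal f gamma, bounded_system f gamma & weakstar_null gamma],
        forall n, closed (F n),
        forall n, F n `&` closure (\bigcup_(m in [set m | m <> n]) F m) = set0 &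
        forall n a, supp (f (n, a)) `<=` F n].

(* Main.v *)
Require Import Defs.
From HB Require Import structures.
From mathcomp Require Import all_boot all_order all_algebra.
From mathcomp Require Import all_classical all_reals all_analysis.
From mathcomp Require Import ring lra.

(** Every functional used is a mixed second difference
[g |-> g p - g q - (g r - g s)] of point evaluations.

On [[0, omega] * [0, c]] the four points are [(n, a + 1)], [(n, a)],
[(omega, a + 1)], [(omega, a)], and [f_(n, a)] is the indicator of
[{n} * (a, c]]: for fixed [n] only finitely many jumps of a continuous function
between [a] and [a + 1] exceed [e], and [g (n, _)] tends to [g (omega, _)]
uniformly.

On a product of spaces [K i], fix points [x i <> y i], a function [u i] separating
them, and distinct coordinates [j n] and [k a]. The four points agree with [x]
except that the coordinates [{j n, k a}], [{j n}], [{k a}], none respectively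
are changed to [y]. A continuous function depends up to [e] on finitely many
coordinates only, so its second difference is small as soon as [j n] or [k a] is not
among them. *)

Set Implicit Arguments.
Unset Strict Implicit.
Unset Printing Implicit Defensive.

Import Order.TTheory GRing.Theory Num.Theory.
Import numFieldNormedType.Exports.
Local Open Scope classical_set_scope.
Local Open Scope card_scope.
Local Open Scope ring_scope.

(** * Second differences of point evaluations as functionals *)

Section FourPoints.
Variables (R : realType) (K : compactHausdorffType).
Implicit Types (g : Cspace R K) (p q r s : K).

Definition four_points p q r s (g : Cspace R K) : R^o :=
  g p - g q - (g r - g s).

Fact four_points_linear p q r s : linear (four_points p q r s).
Proof.
move=> a g h; have E x : (a *: g + h) x = a * g x + h x by [].
by rewrite /four_points !E -[a *: _]/(a * _); ring.
Qed.

HB.instance Definition _ p q r s :=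
  GRing.isLinear.Build R (Cspace R K) R^o *:%R (four_points p q r s)
    (@four_points_linear p q r s).

Lemma four_points_le p q r s g : `|four_points p q r s g| <= 4 * `|g|.
Proof.
have E x : - `|g| <= g x /\ g x <= `|g|.
  by have := sup_norm_ge g x; rewrite ler_norml => /andP[].
have [[? ?] [? ?]] := (E p, E q); have [[? ?] [? ?]] := (E r, E s).
by rewrite /four_points ler_norml; apply/andP; split; lra.
Qed.

Fact four_points_continuous p q r s : continuous (four_points p q r s).
Proof.
apply: bounded_linear_continuous; apply/linear_boundedP.
exists 4; split=> [|t t4 g]; first exact: num_real.
apply: le_trans (four_points_le _ _ _ _ _) _.
by rewrite ler_wpM2r// ltW.
Qed.

Definition four_points_dual p q r s : dual (Cspace R K) :=
  Dual (@four_points_continuous p q r s).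

Lemma dual_norm_four_points p q r s :
  dual_norm (four_points_dual p q r s) <= 4.
Proof.
apply: ge_sup; first by exists `|four_points p q r s 0|, 0; rewrite /= ?normr0.
move=> _ [g /= g1 <-]; apply: le_trans (four_points_le _ _ _ _ _) _.
by rewrite -[leRHS]mulr1 ler_wpM2l.
Qed.

(** Isolates what has to be checked in each example: boundedness comes from the constants 1 and 4,
    and since [F n] is closed, the support condition reduces to the points where [f] is nonzero. *)
Lemma property_star_four_points (F : nat -> set K)
    (f : nat * continuum R -> Cspace R K) (p q r s : nat * continuum R -> K) :
  (forall n, closed (F n)) ->
  (forall n, F n `&` closure (\bigcup_(m in [set m | m <> n]) F m) = set0) ->
  (forall i x, f i x <> 0 -> F i.1 x) ->
  (forall i x, `|f i x| <= 1) ->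
  (forall i, four_points (p i) (q i) (r i) (s i) (f i) = 1) ->
  (forall i j, i <> j -> four_points (p i) (q i) (r i) (s i) (f j) = 0) ->
  (forall g, c0 (fun i => four_points (p i) (q i) (r i) (s i) g)) ->
  property_star R K.
Proof.
move=> Fc Fs fF f1 fii fij gnull.
exists F, f, (fun i => four_points_dual (p i) (q i) (r i) (s i)).
split => //; first split => //.
- split; first by exists 1 => i; exact: sup_norm_le.
  by exists 4 => i; exact: dual_norm_four_points.
- move=> n a; rewrite [X in _ `<=` X](closure_id _).1 //.
  by apply: closure_subset => x /fF.
Qed.

End FourPoints.

(** * Successors and jumps in a closed ordinal interval *)

Section OrdinalInterval.
Context {d : Order.disp_t} {A : wellOrderType d}.
Local Notation oA := (ordinal_itv A).
Implicit Types (a : A) (x y : oA).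

(** The successor lives in the closed interval because it is [None] when [a] is the largest element
    of [A]. *)
Definition is_successor a y :=
  ((Some a : oA) < y)%O /\ forall x, ((Some a : oA) < x)%O -> (y <= x)%O.

Lemma successor_exists a : exists y, is_successor a y.
Proof.
have [|y ay ymin] := @ordinal_itv_well_order _ A [set y | ((Some a : oA) < y)%O].
  by exists None.
by exists y.
Qed.

(** The complement, all points up to [a], is also the open ray below the successor of [a]. *)
Lemma final_segment_clopen a : clopen [set y : oA | ((Some a : oA) < y)%O].
Proof.
have -> : [set y : oA | ((Some a : oA) < y)%O] = [set` `](Some a : oA), +oo[%O].
  by apply/seteqP; split=> y /=; rewrite in_itv/= andbT.
split; first exact: rray_open.
have [b [ab bmin]] := successor_exists a.
rewrite -setCitvl (_ : [set` `]-oo, (Some a : oA)]%O] = [set` `]-oo, b[%O]).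
  exact/open_closedC/lray_open.
apply/seteqP; split=> y /=; rewrite !in_itv/= => yb; first exact: le_lt_trans ab.
by rewrite leNgt; apply/negP => /bmin; rewrite leNgt yb.
Qed.

(* At the least [m] below which there are infinitely many jumps of size [e],
continuity bounds the jumps in some interval [(x, m)]. *)
Lemma finite_jumps (R : realType) (h : oA -> R) (succ : A -> oA) (e : R) :
  continuous h -> (forall a, is_successor a (succ a)) -> 0 < e ->
  finite_set [set a | e <= `|h (succ a) - h (Some a)|].
Proof.
move=> hc succP e0; pose J := [set a | e <= `|h (succ a) - h (Some a)|].
suff fin k : finite_set [set a | J a /\ ((Some a : oA) < k)%O].
  by apply: sub_finite_set (fin None) => a Ja.
apply: contrapT => infk; pose S := [set m : oA |
  ~ finite_set [set a | J a /\ ((Some a : oA) < m)%O]].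
have [|m Sm mmin] := @ordinal_itv_well_order _ A S; first by exists k.
have : \forall y \near (m : oA), `|h m - h y| < e / 2.
  by move/(_ m): hc => /cvgrPdist_lt; apply; rewrite divr_gt0.
rewrite /prop_near1 itv_nbhsE => -[[b c] [oi mi] iU].
move: mi => /andP[/= bm mc].
(* The successor of [a] is still at most [m], so both ends of the jump lie where [h] is within
   [e / 2] of [h m]. *)
have small a : (b <= BLeft (Some a : oA))%O -> ((Some a : oA) < m)%O -> ~ J a.
  move=> ba am; have [asa sale] := succP a.
  have U y : (b <= BLeft y)%O -> (y <= m)%O -> `|h m - h y| < e / 2.
    by move=> by_ ym; apply: iU; apply/andP; split => //=; apply: le_trans mc.
  have /U/(_ (sale _ am)) hs : (b <= BLeft (succ a))%O.
    by apply: le_trans ba _; rewrite bnd_simp ltW.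
  have /U/(_ (ltW am)) ha := ba.
  have := ler_normB (h m - h (Some a)) (h m - h (succ a)); rewrite /J/=.
  rewrite (_ : _ - _ - _ = h (succ a) - h (Some a)); first by lra.
  by ring.
case: b bm small oi {iU} => [[] x|[]] bm small oi.
- by move: oi; case: c {mc} => [[]|[]].
- have xm : (x < m)%O by [].
  apply: Sm; have /contrapT fx : ~ S x by move=> /mmin; rewrite leNgt xm.
  (* The interval is open at [x], so [x] needs separate care: below [m] there remain the jumps below
     [x], finite by minimality of [m], and at most one at [x]. *)
  have fx1 : finite_set [set a | Some a = x].
    case: x {bm small xm fx oi} => [a|]; last by apply: sub_finite_set (finite_set0 A).
    by apply: sub_finite_set (finite_set1 a) => b [->].
  have : finite_set ([set a | J a /\ ((Some a : oA) < x)%O] `|` [set a | Some a = x]).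
    by rewrite finite_setU.
  apply: sub_finite_set.
  move=> a [Ja am]; have [ax|xa|ax] := ltgtP (Some a : oA) x; [by left| |by right].
  by case: (small a _ am Ja); rewrite bnd_simp.
- apply: Sm; apply: sub_finite_set (finite_set0 A) => a [Ja am].
  by case: (small a _ am Ja).
- by [].
Qed.

End OrdinalInterval.

(** * Indicators of clopen sets and the space [0, omega] * [0, c] *)

Lemma indic_clopen_continuous (R : realType) (T : topologicalType) (D : set T) :
  clopen D -> continuous (\1_D : T -> R).
Proof.
move=> [oD cD] x U; rewrite indicE => Ux; have [xD|xD] := boolP (x \in D).
  apply: (@filterS _ (nbhs x) _ D); last exact: open_nbhs_nbhs (conj oD (set_mem xD)).
  move=> y Dy /=; rewrite indicE (mem_set Dy).
  by move: Ux; rewrite xD => /nbhs_singleton.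
apply: (@filterS _ (nbhs x) _ (~` D)).
  move=> y Dy /=; rewrite indicE memNset//.
  by move: Ux; rewrite (negbTE xD) => /nbhs_singleton.
apply: open_nbhs_nbhs; split; first exact: closed_openC.
by move=> /mem_set; apply/negP.
Qed.

Section OrdinalProduct.
Variable R : realType.
Local Notation oN := (ordinal_itv nat).
Local Notation oC := (ordinal_itv (continuum R)).

Lemma clopen_isolated (n : nat) : clopen [set (Some n : oN)].
Proof.
have -> : [set (Some n : oN)] = ~` [set y : oN | (Some n : oN) < y]%O `&`
    (if n is m.+1 then [set y : oN | (Some m : oN) < y]%O else setT).
  apply/seteqP; split => [_ -> |y [/negP]]; rewrite /= ?ltxx.
    by split => //; case: n => //= m; rewrite ltNge -[(_ <= _)%O]/(m.+1 <= m)%N ltnn.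
  rewrite -leNgt; case: y => [k|//]; case: n => [|n].
    by rewrite -[(_ <= _)%O]/(k <= 0)%N leqn0 => /eqP ->.
  rewrite -[(_ <= _)%O]/(k <= n.+1)%N => kn /= nk.
  congr Some; apply/eqP; rewrite eqn_leq kn /=.
  by rewrite ltnNge; move: nk; rewrite ltNge.
apply: clopenI; first exact/(clopenC set0)/final_segment_clopen.
by case: n => [|n]; [exact: clopenT|exact: final_segment_clopen].
Qed.

Lemma nbhs_omega_cofinite (P : oN -> Prop) :
  (\forall x \near (None : oN), P x) -> finite_set [set n | ~ P (Some n)].
Proof.
rewrite /prop_near1 itv_nbhsE => -[[b c] [oi mi] iU].
move: mi => /andP[/= bm mc].
(* An open interval containing the top point has no right endpoint. *)
have c1 : c = +oo%O.
  by clear bm iU; case: b oi => [[] ?|[]]; case: c mc => [[] [?|]|[]].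
subst c; case: b bm oi iU => [[] x|[]] bm oi iU //.
  case: x bm oi iU => [k|] bm oi iU //.
  apply: sub_finite_set (finite_II k.+1) => n /= Pn.
  rewrite ltnNge; apply/negP => kn; apply: Pn; apply: iU.
  by rewrite /= in_itv/= andbT ltNge -[(_ <= _)%O]/(n <= k)%N -ltnNge.
by apply: sub_finite_set (finite_set0 _) => n; apply => /=; exact: iU.
Qed.

Lemma property_star_ordinal_product : property_star R (oN * oC)%type.
Proof.
have [succ succP] := choice (@successor_exists _ (continuum R)).
pose F n : set (oN * oC) := fst @^-1` [set Some n].
have cF n : clopen (F n).
  by apply: preimage_clopen (clopen_isolated n) _ => x; exact: cvg_fst.
pose D (i : nat * continuum R) : set (oN * oC) :=
  F i.1 `&` snd @^-1` [set y | (Some i.2 : oC) < y]%O.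
have cD i : clopen (D i).
  apply: clopenI (cF _) _; apply: preimage_clopen (final_segment_clopen _) _ => x.
  exact: cvg_snd.
pose f i : Cspace R (oN * oC)%type := CspaceOf (@indic_clopen_continuous R _ _ (cD i)).
have fE n a x y : f (n, a) (x, y) = ((x == Some n) && ((Some a : oC) < y)%O)%:R.
  rewrite -[LHS]/(\1_(D (n, a)) (x, y)) indicE.
  congr (_%:R); congr nat_of_bool; apply/idP/idP.
    by rewrite inE => -[/= xn ay]; apply/andP; split => //; apply/eqP.
  by move=> /andP[/eqP -> ay]; rewrite inE.
apply: (@property_star_four_points R (oN * oC)%type F f
  (fun i => (Some i.1, succ i.2)) (fun i => (Some i.1, Some i.2))
  (fun i => (None, succ i.2)) (fun i => (None, Some i.2))).
- by move=> n; case: (cF n).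
- move=> n; rewrite setIC; apply/disjoints_subset.
  apply: subset_trans (closure_subset (_ : _ `<=` ~` F n)) _.
    by move=> [x y] [m mn xm xn]; apply: mn; case: (etrans (esym xm) xn).
  by rewrite -(closure_id _).1 //; apply: open_closedC; case: (cF n).
- by move=> [n a] [x y]; rewrite fE /F /=; case: eqP => //=.
- by move=> [n a] [x y]; rewrite fE ger0_norm ?ler0n// lern1; case: (_ && _).
- move=> [n a]; rewrite /four_points !fE /= eqxx ltxx.
  by have [-> _] := succP a; rewrite !subr0.
- move=> [n a] [m b] ij; rewrite /four_points !fE /= !subr0.
  have [[nm]|] := eqVneq (Some n : option nat) (Some m); last by rewrite !subr0.
  (* The indicator of the points above [b] changes only between [b] and its successor, so it takes
     equal values at [a] and [succ a] unless [a] is [b]. *)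
  have [aS Smin] := succP a; have [ba|ab|[ab]] := ltgtP (Some b : oC) (Some a).
  - by rewrite (lt_trans ba aS) subrr.
  - by rewrite ltNge Smin// subrr.
  - by case: ij; rewrite nm ab.
- move=> g e e0; have gc z : {for z, continuous g} by exact: Cspace_continuous.
  pose good (n : oN) := forall y, `|g (None, y) - g (n, y)| < e / 2.
  have fin_bad : finite_set [set n | ~ good (Some n)].
    (* Tube argument: compactness of [0, c] makes continuity at the points of the row omega uniform
       along that row. Two errors of [e / 4], one in each row, add up to [e / 2]. *)
    apply: nbhs_omega_cofinite; have := @compactT oC.
    move=> /compact_near_coveringP/(_ _ (nbhs (None : oN)) (fun n y =>
      `|g (None, y) - g (n, y)| < e / 2) _) cov.
    have : \forall n \near (None : oN), [set: oC] `<=`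
        (fun y => `|g (None, y) - g (n, y)| < e / 2).
      apply: cov => y _; have /cvgrPdist_lt/(_ (e / 4)) := gc (None, y).
      case=> [|[U V] [/= UN Vy] UVg]; first by rewrite divr_gt0.
      exists (V, U) => // -[y' n] [/= Vy' Un].
      have /= g1 := UVg (None, y') (conj (nbhs_singleton UN) Vy').
      have /= g2 := UVg (n, y') (conj Un Vy').
      by move: g1 g2; rewrite !ltr_norml => /andP[? ?] /andP[? ?]; apply/andP; split; lra.
    by apply: filterS => n ng y; exact: ng.
  have sc n : continuous (fun y => g (n, y)).
    move=> y; apply: (@continuous_comp oC (oN * oC)%type R (pair n) g) => //.
    move=> U [[V W] /= [Vn Wy] VWU]; apply: filterS Wy => z Wz.
    by apply: VWU; split => //; exact: nbhs_singleton Vn.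
  pose h (n : nat) (y : oC) := g (Some n, y) - g (None, y).
  have hc n : continuous (h n) by move=> y; exact: (cvgB (@sc (Some n) y) (@sc None y)).
  have hE n a : @four_points R (oN * oC)%type (Some n, succ a) (Some n, Some a)
      (None, succ a) (None, Some a) g = h n (succ a) - h n (Some a).
    by rewrite /four_points /h; ring.
  (* On a good row two errors below [e / 2] keep the second difference below [e]; each of the
     finitely many bad rows has finitely many large jumps. *)
  apply: (@sub_finite_set _ _ (\bigcup_(n in [set n | ~ good (Some n)])
     (pair n) @` [set a | e <= `|h n (succ a) - h n (Some a)|])); last first.
    by apply: bigcup_finite => // n _; apply: finite_image; exact: finite_jumps.
  move=> [n a] /=; rewrite hE => hna; exists n; last by exists a.
  move=> gn; move: hna; have := gn (succ a); have := gn (Some a).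
  rewrite leNgt /h ltr_norml => /andP[? ?]; rewrite ltr_norml => /andP[? ?] /negP; apply.
  by rewrite ltr_norml; apply/andP; split; lra.
Qed.

End OrdinalProduct.

(** * Separating functions and finite dependence on coordinates *)

Lemma point_separation (R : realType) (K : compactHausdorffType) (x y : K) :
  x <> y -> exists u : K -> R,
    [/\ continuous u, forall z, 0 <= u z <= 1, u x = 0 & u y = 1].
Proof.
move=> xy; have acc := hausdorff_accessible (@hausdorffT K).
have nor := compact_normal (@hausdorffT K) (@compactT K).
have /(@uniform_separatorP _ R)[u [uc u01 ux uy]] : uniform_separator [set x] [set y].
  apply: (@normal_completely_regular R K nor acc x [set y]) => //.
  exact: accessible_closed_set1.
exists u; split => // [z||].
- by have /= := u01 (u z) (ex_intro2 _ _ z Logic.I erefl); rewrite in_itv.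
- by apply: ux; exists x.
- by apply: uy; exists y.
Qed.

Section FiniteDependence.
Variables (I : Type) (K : I -> compactHausdorffType).
Local Notation P := (prod_topology K).
Implicit Types (x y z : P) (J : set I).

Definition agree J x y := forall i, J i -> x i = y i.

Lemma prod_coordinate_continuous i : continuous (fun x : P => x i).
Proof. exact: (@proj_continuous {classic I} K i). Qed.

(** The sets that contain such a [W] form a filter. It converges to [x] in each coordinate, hence in
    the product topology, which is the supremum of the coordinate topologies. *)
Lemma nbhs_prod_finite x (N : set P) : nbhs x N ->
  exists J W, [/\ finite_set J, nbhs x W, W `<=` N &
    forall y z, agree J y z -> W y -> W z].
Proof.
pose F : set_system P := [set A | exists J W, [/\ finite_set J, nbhs x W,
  W `<=` A & forall y z, agree J y z -> W y -> W z]].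
have FF : Filter F.
  split.
  - by exists set0, setT; split => //; exact: filterT.
  - move=> A B [J [V [finJ xV VA JV]]] [L [W [finL xW WB LW]]].
    exists (J `|` L), (V `&` W); split.
    + by rewrite finite_setU.
    + exact: filterI.
    + exact: setISS.
    + move=> y z yz [Vy Wy]; split.
        by apply: JV Vy => i Ji; apply: yz; left.
      by apply: LW Wy => i Li; apply: yz; right.
  - move=> A B AB [J [W [finJ xW WA JW]]]; exists J, W; split => //.
    exact: subset_trans WA AB.
suff : F --> x by apply.
apply/cvg_sup => i A [B [[C oC <-] Cx] CA].
exists [set i], [set y : P | C (y i)]; split => //.
- by apply: prod_coordinate_continuous; exact: open_nbhs_nbhs.
- by move=> y z yz; rewrite /= yz.
Qed.

Lemma continuous_prod_finite (R : realType) (g : P -> R) (e : R) :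
  continuous g -> 0 < e ->
  exists2 J, finite_set J & forall x y, agree J x y -> `|g x - g y| < e.
Proof.
move=> gc e0.
(* Along this filter, eventually means for all sufficiently large sets of coordinates; compactness
   then turns the local choices of a finite set into one global choice. *)
pose F : set_system (set I) := filter_from finite_set (fun J => [set L | J `<=` L]).
have FF : Filter F.
  apply: filter_from_filter; first by exists set0.
  move=> J L finJ finL; exists (J `|` L); first by rewrite finite_setU.
  by move=> M /= JLM; split=> i ?; apply: JLM; [left|right].
have /compact_near_coveringP cov := @compactT P.
have [|J finJ cJ] := cov _ F (fun J x => forall y, agree J x y -> `|g x - g y| < e) FF.
  move=> x _; have /cvgrPdist_lt/(_ (e / 2)) := gc x.
  case/(_ _)/nbhs_prod_finite => [|J [W [finJ xW Wg JW]]]; first by rewrite divr_gt0.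
  exists (W, [set L | J `<=` L]); first by split => //; exists J.
  move=> [z L] [/= Wz JL] y zy.
  have := Wg _ Wz; have /Wg /= : W y by apply: JW Wz => i /JL; exact: zy.
  by rewrite !ltr_norml => /andP[? ?] /andP[? ?]; apply/andP; split; lra.
by exists J => // x y; apply: (cJ J).
Qed.

End FiniteDependence.

(** * The biorthogonal system on a product with chosen coordinates *)

Section CompactProduct.
Variables (R : realType) (I : Type) (K : I -> compactHausdorffType).
Local Notation P := (prod_topology K).
Variables (x y : forall i, K i) (u : forall i, K i -> R).
Arguments u : clear implicits.
Hypothesis u_cont : forall i, continuous (u i).
Hypothesis u01 : forall i z, 0 <= u i z <= 1.
Hypothesis ux : forall i, u i (x i) = 0.
Hypothesis uy : forall i, u i (y i) = 1.
Variables (j : nat -> I) (k : continuum R -> I).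
Hypothesis j_inj : injective j.
Hypothesis k_inj : injective k.
Hypothesis jk : forall n a, j n <> k a.

Let pt (S : set I) : P := fun i => if `[< S i >] then y i else x i.
Let v i (z : P) : R := u i (z i).
Let sum_v n (z : P) : R := \sum_(m < n) v (j m) z.
(** The map [3 * t - 2] sends 2/3 to 0 and 1 to 1, so [peak n] vanishes off [F n] and equals 1 at
    [pt S] when [j n] is the first of the [j m] in [S]. *)
Let peak n (z : P) : R := Num.max 0 (3 * (v (j n) z - sum_v n z) - 2).
(* On [F m] with [m > n], the subtracted sum keeps [v (j n)] below [1 / 3]; this
is what separates [F n] from all later [F m] at once. *)
Let F n := [set z : P | 2 / 3 <= v (j n) z - sum_v n z].

Let v_cont i : continuous (v i).
Proof.
move=> z; apply: (@continuous_comp P (K i) R (fun z => z i) (u i)); last exact: u_cont.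
exact: prod_coordinate_continuous.
Qed.

Let sum_v_cont n : continuous (sum_v n).
Proof.
elim: n => [|n IH] z.
  have -> : sum_v 0 = cst 0 by apply/funext => t; rewrite /sum_v big_ord0.
  exact: (@cst_continuous P R).
have -> : sum_v n.+1 = (fun t => sum_v n t + v (j n) t).
  by apply/funext => t; rewrite /sum_v big_ord_recr.
exact: (cvgD (@IH z) (@v_cont _ z)).
Qed.

Let sn_cont n : continuous (fun z : P => v (j n) z - sum_v n z).
Proof. by move=> z; exact: (cvgB (@v_cont _ z) (@sum_v_cont _ z)). Qed.

Let peak_cont n : continuous (peak n).
Proof.
move=> z; apply: (@continuous_max R P (cst 0)); first exact: (@cst_continuous P R).
have cc c : {for z, continuous (fun=> c : R)} by exact: (@cst_continuous P R).
exact: (cvgB (cvgM (cc 3) (@sn_cont n z)) (cc 2)).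
Qed.

Let v_ge0 i z : 0 <= v i z. Proof. by case/andP: (u01 (z i)). Qed.
Let v_le1 i z : v i z <= 1. Proof. by case/andP: (u01 (z i)). Qed.

Let sum_v_ge0 n z : 0 <= sum_v n z. Proof. by apply: sumr_ge0. Qed.

Let v_le_sum m n z : (m < n)%N -> v (j m) z <= sum_v n z.
Proof.
by move=> mn; rewrite /sum_v (bigD1 (Ordinal mn)) //= lerDl sumr_ge0.
Qed.

Let v_pt i S : v i (pt S) = (`[< S i >])%:R.
Proof. by rewrite /v /pt; case: asboolP. Qed.

Let peak0 n S : ~ S (j n) -> peak n (pt S) = 0.
Proof.
move=> Sn; apply/max_idPl; rewrite v_pt asboolF// mulr0n.
by have := @sum_v_ge0 n (pt S); lra.
Qed.

Let peak1 n S : S (j n) -> (forall m, (m < n)%N -> ~ S (j m)) -> peak n (pt S) = 1.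
Proof.
move=> Sn Sm; rewrite /peak v_pt asboolT// (_ : sum_v n (pt S) = 0).
  by rewrite subr0 mulr1 max_r//; lra.
by apply: big1 => m _; rewrite v_pt asboolF//; exact: Sm.
Qed.

Let f_cont n a : continuous (fun z : P => peak n z * v (k a) z).
Proof. by move=> z; exact: (cvgM (@peak_cont n z) (@v_cont _ z)). Qed.

Let agree_pt J S T : (forall i, J i -> S i <-> T i) -> agree J (pt S) (pt T).
Proof. by move=> ST i Ji; rewrite /pt (asbool_equiv_eq (ST i Ji)). Qed.

Lemma property_star_coordinates : property_star R P.
Proof.
pose A n a := [set j n] `|` [set k a].
(* At [pt S] the first factor vanishes unless [S] contains [j n], the second unless it contains
   [k a]; so only the first of the four points can contribute. *)
pose f i : Cspace R P := CspaceOf (@f_cont i.1 i.2).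
have fE n a z : f (n, a) z = peak n z * v (k a) z by [].
have A_j m n a : A n a (j m) <-> m = n.
  by split=> [[/j_inj|/jk]|->] //; left.
have A_k n a b : A n a (k b) <-> b = a.
  by split=> [[/esym/jk|/k_inj]|->] //; right.
have r0 m a : peak m (pt [set k a]) = 0 by apply: peak0 => /jk.
have s0 m : peak m (pt set0) = 0 by apply: peak0.
have q0 n a : v (k a) (pt [set j n]) = 0.
  by rewrite v_pt asboolF// => /esym/jk.
apply: (@property_star_four_points R P F f (fun i => pt (A i.1 i.2))
  (fun i => pt [set j i.1]) (fun i => pt [set k i.2]) (fun=> pt set0)).
- by move=> n; exact: ((continuous_closedP _).1 (@sn_cont n) _ (@closed_ge R (2 / 3))).
- move=> n; rewrite setIC; apply/disjoints_subset.
  (* A closed set disjoint from [F n] that contains every other [F m]: the first condition holds for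
     [m > n], the second for [m < n], where [v (j m)] is a term of [sum_v n]. *)
  pose C := [set z | v (j n) z <= 1 / 3] `|` [set z | 2 / 3 <= sum_v n z].
  have cC : closed C.
    apply: closedU.
      exact: ((continuous_closedP _).1 (@v_cont (j n)) _ (@closed_le R (1 / 3))).
    exact: ((continuous_closedP _).1 (@sum_v_cont n) _ (@closed_ge R (2 / 3))).
  apply: (@subset_trans _ C); last first.
    by rewrite /F => z [] /= ? ?; have := sum_v_ge0 n z; have := v_le1 (j n) z; lra.
  rewrite [X in _ `<=` X](closure_id _).1//; apply: closure_subset => z [m mn Fm].
  have [mn'|nm|//] := ltngtP m n; [right|left]; rewrite /F /= in Fm *.
    by have := v_le_sum z mn'; have := sum_v_ge0 m z; lra.
  by have := v_le_sum z nm; have := v_le1 (j m) z; lra.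
- move=> [n a] z; rewrite fE => fz; rewrite /F /= leNgt; apply/negP => Fz; apply: fz.
  rewrite /peak max_l ?mul0r//; lra.
- move=> [n a] z; rewrite fE normrM -[leRHS]mulr1.
  rewrite ler_pM// ?(ger0_norm (v_ge0 _ _)) ?v_le1//.
  rewrite ger0_norm /peak ?le_max ?lexx// ge_max ler01 /=.
  by have := sum_v_ge0 n z; have := v_le1 (j n) z; lra.
- move=> [n a]; rewrite /four_points !fE /= peak1; last 2 first.
  + exact/A_j.
  + by move=> m mn /A_j mE; rewrite mE ltnn in mn.
  by rewrite r0 s0 q0 v_pt asboolT; [rewrite !mul0r !mulr0 !subr0 mulr1|exact/A_k].
- move=> [n a] [m b] ij; rewrite /four_points !fE /= r0 s0 q0.
  rewrite !mul0r !mulr0 !subr0; have [nm|nm] := eqVneq n m.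
    rewrite v_pt asboolF ?mulr0// => /A_k ba; by case: ij; rewrite nm ba.
  by rewrite peak0 ?mul0r// => /A_j mn; rewrite mn eqxx in nm.
- move=> g e e0.
  have [|J finJ Jg] :=
    continuous_prod_finite (@Cspace_continuous _ _ g) (_ : 0 < e / 2).
    by rewrite divr_gt0.
  have Jpt S T : (forall i, J i -> S i <-> T i) -> `|g (pt S) - g (pt T)| < e / 2.
    by move=> ST; exact/Jg/agree_pt.
  apply: (@sub_finite_set _ _ ((j @^-1` J) `*` (k @^-1` J))); last first.
    by apply: finite_setX; apply: finite_preimage => // ? ? _ _;
      [exact: j_inj|exact: k_inj].
  move=> [n a] /=; apply: contraPP.
  (* If [j n] is outside [J], pair the points that differ only at [j n]; otherwise pair those that
     differ only at [k a]. Each pair contributes less than [e / 2]. *)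
  move=> /not_andP[nJ|aJ]; apply/negP; rewrite -ltNge /four_points.
    have /ltr_normlP[? ?] : `|g (pt (A n a)) - g (pt [set k a])| < e / 2.
      by apply: Jpt => i Ji; split=> [[ij|//]|ik]; [case: nJ; rewrite -ij|right].
    have /ltr_normlP[? ?] : `|g (pt [set j n]) - g (pt set0)| < e / 2.
      by apply: Jpt => i Ji; split=> // ij; case: nJ; rewrite -ij.
    by rewrite ltr_norml; apply/andP; split; lra.
  have /ltr_normlP[? ?] : `|g (pt (A n a)) - g (pt [set j n])| < e / 2.
    by apply: Jpt => i Ji; split=> [[//|ik]|ij]; [case: aJ; rewrite -ik|left].
  have /ltr_normlP[? ?] : `|g (pt [set k a]) - g (pt set0)| < e / 2.
    by apply: Jpt => i Ji; split=> // ik; case: aJ; rewrite -ik.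
  by rewrite ltr_norml; apply/andP; split; lra.
Qed.

End CompactProduct.

(** * Products of at least continuum many nontrivial factors *)

Lemma property_star_product (R : realType) (I : Type) (K : I -> compactHausdorffType) :
  [set: continuum R] #<= [set: I] -> (forall i, exists x y : K i, x <> y) ->
  property_star R (prod_topology K).
Proof.
move=> /card_leP[i0] K2.
pose i (x : R) : I := set_val (i0 (to_setT (x : continuum R))).
have i_inj : injective i.
  move=> x y /val_inj/(@inj _ _ _ i0); rewrite !inE.
  by move=> /(_ Logic.I Logic.I)/(congr1 set_val).
have sep l : {t : K l * K l * (K l -> R) | [/\ continuous t.2,
    forall z, 0 <= t.2 z <= 1, t.2 t.1.1 = 0 & t.2 t.1.2 = 1]}.
  apply: cid; have [x [y xy]] := K2 l.
  by have [u uP] := point_separation R xy; exists (x, y, u).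
(* The reals [- n%:R] are nonpositive and the [expR a] positive, which gives two disjoint injective
   families of coordinates. *)
apply: (@property_star_coordinates R I K
  (fun l => (sval (sep l)).1.1) (fun l => (sval (sep l)).1.2)
  (fun l => (sval (sep l)).2) _ _ _ _ (fun n => i (- n%:R)) (fun a => i (expR a))).
- by move=> l; case: (svalP (sep l)).
- by move=> l; case: (svalP (sep l)).
- by move=> l; case: (svalP (sep l)).
- by move=> l; case: (svalP (sep l)).
- by move=> m n /i_inj/oppr_inj/eqP; rewrite eqr_nat => /eqP.
- by move=> a b /i_inj/expR_inj.
- move=> n a /i_inj na; have := expR_gt0 (a : R).
  by rewrite -na oppr_gt0 ltrn0.
Qed.

Theorem corollary2p10 (R : realType) :
  [/\ property_star R (ordinal_itv nat * ordinal_itv (continuum R))%type,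
      property_star R (prod_topology (fun _ : continuum R => bool))
    & forall (I : Type) (K : I -> compactHausdorffType),
        [set: continuum R] #<= [set: I] ->
        (forall i, exists x y : K i, x <> y) ->
        property_star R (prod_topology K)].
Proof.
split; first exact: property_star_ordinal_product.
- apply: property_star_product => // _; by exists true, false.
- exact: property_star_product.
Qed.
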